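(* Let $p\ge 0$ be an integer, let $a\ge 0$, and let $q$ be a super-critical offspring distribution ($\mu>1$) that admits a moment of order $p$ (and that satisfies the $L\log L$ condition $\mathbb{E}[Z_1\log Z_1]<+\infty$ if $p<2$). Then for every integer $n_0\ge 0$ the probability measures $\mathbf{Q}_{n_0}^{(p)}$ (law of the inhomogeneous multi-type Galton-Watson tree with root of type $p$ at height $n_0$) and $\mathbb{Q}_{n_0}^{(p)}$ (change of measure of $\mathbb{P}_{n_0}$ by the martingale $(M_{n,n_0}^{(p)})_{n\ge n_0}$), both defined in the context, coincide as laws of the random tree $\tau$.
   Context: **Trees.** $\mathscr{U}=\bigcup_{n\ge0}(\mathbb{N}^* )^n$ is the set of finite words of positive integers, with $(\mathbb{N}^* )^0=\{\partial\}$ and $|u|$ the length of $u$; for $u\neq\partial$, $\bar u$ is $u$ with its last letter removed. A tree $\mathbf{t}$ rooted at $u\in\mathscr{U}$ is a subset of $\mathscr{U}$ such that $u\in\mathbf{t}$; $|v|<|u|$ implies $v\notin\mathbf{t}$; $v\in\mathbf{t}\setminus\{u\}$ implies $\bar v\in\mathbf{t}$; and for all $v\in\mathbf{t}$ there is $k_v(\mathbf{t})\in\mathbb{N}$ with $vi\in\mathbf{t}\iff i\le k_v(\mathbf{t})$ for all $i\in\mathbb{N}^*$. Let $\mathbf{1}_n=(1,\dots,1)\in(\mathbb{N}^* )^n$ ($\mathbf{1}_0=\partial$), $\mathbb{T}_n$ the set of trees rooted at $\mathbf{1}_n$, $\mathbb{T}_n^{(h)}$ those of height $\max\{|u|:u\in\mathbf{t}\}$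 at most $h$. Set $r_n(\mathbf{t})=\{u\in\mathbf{t}:|u|\le n\}$ and $z_n(\mathbf{t})=\mathrm{Card}\{u\in\mathbf{t}:|u|=n\}$. The law of a random tree $\tau$ is characterized by the probabilities of the events $\{r_n(\tau)=\mathbf{t}\}$. **Galton-Watson trees.** $q=(q_n)_{n\in\mathbb{N}}$ is a probability on $\mathbb{N}$ with finite mean $\mu$. Under $\mathbb{P}_{k}$, $\tau$ is the Galton-Watson tree with offspring distribution $q$ rooted at $\mathbf{1}_k$ (one individual at height $k$): for $h>k$ and $\mathbf{t}\in\mathbb{T}_k^{(h)}$, $\mathbb{P}_k(r_h(\tau)=\mathbf{t})=\prod_{u\in r_{h-1}(\mathbf{t})}q_{k_u(\mathbf{t})}$. $\mathbb{P}=\mathbb{P}_0$, $Z_n=z_n(\tau)$, and $\mathscr{F}_n$ is the $\sigma$-field generated by $r_n(\tau)$. $W$ is the a.s. limit under $\mathbb{P}$ of the martingale $Z_n/\mu^n$ and $\phi(b)=\mathbb{E}[e^{-bW}]$, $b\ge0$; $\phi^{(k)}$ is its $k$-th derivative (one-sided at $0$), $\phi^{(0)}=\phi$. Convention: $0\log0=0$. **The measure $\mathbb{Q}_{n_0}^{(p)}$.** Let $H_0(x)=1$, $H_k(x)=\frac1{k!}\prod_{j=0}^{k-1}(x-j)$ for $k\ge1$; $S_{i,p}=\{(n_1,\dots,n_i)\in(\mathbb{N}^* )^i:\ n_1+\cdots+n_i=p\}$; $a_i^{(p)}(n)=\sum_{(n_1,\ldots,n_i)\in S_{i,p}}\prod_{r=1}^i\frac{\phi^{(n_r)}(a/\mu^n)}{n_r!}$.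 For $n\ge n_0$ let $$G_{n,n_0}^{(0)}(x)=\frac{\phi(a/\mu^n)^x}{\phi(a/\mu^{n_0})},\qquad G_{n,n_0}^{(p)}(x)=\frac{p!}{\phi^{(p)}(a/\mu^{n_0})}\sum_{i=1}^p a_i^{(p)}(n)H_i(x)\phi(a/\mu^n)^{x-i}\quad(p\ge1),$$ and $M_{n,n_0}^{(p)}=\mu^{-p(n-n_0)}G_{n,n_0}^{(p)}(Z_n)$, which is a mean-one nonnegative martingale $(n\ge n_0)$ under $\mathbb{P}_{n_0}$. $\mathbb{Q}_{n_0}^{(p)}$ is the probability measure on trees such that $\frac{d\mathbb{Q}_{n_0}^{(p)}}{d\mathbb{P}_{n_0}}\big|_{\mathscr{F}_n}=M_{n,n_0}^{(p)}$ for all $n\ge n_0$. **The measure $\mathbf{Q}_{n_0}^{(p)}$.** Under $\mathbf{Q}_{n_0}^{(p)}$, $\tau$ is (the tree, types forgotten, of) an inhomogeneous multi-type Galton-Watson tree with types in $\{0,\dots,p\}$ such that: the root is of type $p$ and starts at height $n_0$ (i.e. is $\mathbf{1}_{n_0}$); a node of type $\ell$ at height $n$ gives, independently of the other nodes, $k$ offspring with respective types $(\ell_1,\dots,\ell_k)\in\mathbb{N}^k$ satisfying $\ell_1+\cdots+\ell_k=\ell$ with probability $$q_k\,\frac{1}{\mu^\ell}\,\frac{\ell!}{\phi^{(\ell)}(a/\mu^n)}\prod_{j=1}^k\frac{\phi^{(\ell_j)}(a/\mu^{n+1})}{\ell_j!}.$$ *)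

(* Defs.v *)
From HB Require Import structures.
From mathcomp Require Import all_boot all_order all_algebra.
From mathcomp Require Import finmap.
From mathcomp Require Import all_classical all_reals all_analysis.

Set Implicit Arguments.
Unset Strict Implicit.
Unset Printing Implicit Defensive.

Import Order.TTheory GRing.Theory Num.Theory.
Import numFieldNormedType.Exports.

Local Open Scope classical_set_scope.
Local Open Scope ring_scope.

(** * Trees *)

(* A finite word of integers; the letters of a node of a tree are required to
   be positive in [is_tree]. *)
Definition word := seq nat.

Definition parent (u : word) : word := take (size u).-1 u.

Definition ones (k : nat) : word := nseq k 1%N.

Definition is_tree (u : word) (t : set word) : Prop :=
  [/\ forall v, t v -> all (fun i => 0 < i)%N v,
      t u,
      forall v, (size v < size u)%N -> ~ t v,
      forall v, t v -> v <> u -> t (parent v)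
    & forall v, t v ->
        exists k : nat, forall i : nat, (0 < i)%N -> (t (rcons v i) <-> (i <= k)%N)].

Record tree (k : nat) := Tree {
  nodes :> set word;
  treeP : is_tree (ones k) nodes }.

Lemma is_tree_root (u : word) :
  all (fun i => 0 < i)%N u -> is_tree u [set u].
Proof.
move=> u0; split=> //.
- by move=> v ->.
- by move=> v vu /= vE; rewrite vE ltnn in vu.
- move=> v ->; exists 0%N => i i0; split.
    by move=> /= /(congr1 size); rewrite size_rcons => /eqP; rewrite eqn_leq ltnn.
  by rewrite leqNgt i0.
Qed.

Lemma ones_pos (k : nat) : all (fun i => 0 < i)%N (ones k).
Proof. by rewrite all_nseq orbT. Qed.

Definition root_tree (k : nat) : tree k := Tree (is_tree_root (ones_pos k)).

HB.instance Definition _ (k : nat) := gen_eqMixin (tree k).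
HB.instance Definition _ (k : nat) := gen_choiceMixin (tree k).
HB.instance Definition _ (k : nat) := isPointed.Build (tree k) (root_tree k).

(* k_v(t), characterized by: vi is in t iff i <= k_v(t). *)
Definition nb_children (t : set word) (v : word) : nat :=
  xget 0%N [set k : nat |
    forall i : nat, (0 < i)%N -> (t (rcons v i) <-> (i <= k)%N)].

Definition height_le (h : nat) (t : set word) : Prop :=
  forall u, t u -> (size u <= h)%N.

(* r_h(t) *)
Definition restr (h : nat) (t : set word) : set word :=
  [set u | t u /\ (size u <= h)%N].

(* z_n(t) *)
Definition gen_size (n : nat) (t : set word) : nat :=
  #|` fset_set [set u | t u /\ size u = n] |%fset.

(** * The space of trees rooted at 1_k *)

(* The events {r_h(tau) = t}, for t rooted at 1_k of height at most h. *)
Definition trunc_events (k h : nat) : set_system (tree k) :=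
  [set A | exists2 t : tree k, height_le h t &
             A = [set tau : tree k | restr h tau = t]].

Definition all_trunc_events (k : nat) : set_system (tree k) :=
  [set A | exists h : nat, trunc_events h A].

Notation tree_space k := (g_sigma_algebraType (@all_trunc_events k)).

(* The sigma-field F_n generated by r_n(tau). *)
Definition filtr (k n : nat) : set_system (tree k) := <<s @trunc_events k n >>.
Arguments filtr : clear implicits.

(** * Galton-Watson trees *)

Section GaltonWatson.
Context {R : realType}.
Local Open Scope ereal_scope.

Definition offspring_distribution (q : nat -> R) : Prop :=
  (forall k, (0 <= q k)%R) /\ \sum_(0 <= k <oo) (q k)%:E = 1.

Definition has_mean (q : nat -> R) (mu : R) : Prop :=
  \sum_(0 <= k <oo) (k%:R * q k)%:E = mu%:E.

Definition has_moment (q : nat -> R) (p : nat) : Prop :=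
  \sum_(0 <= k <oo) (k%:R ^+ p * q k)%:E < +oo.

Definition is_GW (q : nat -> R) (k : nat)
    (P : probability (tree_space k) R) : Prop :=
  forall (h : nat) (t : tree k), (k < h)%N -> height_le h t ->
    P [set tau : tree k | restr h tau = t] =
    (\big[*%R/1%R]_(u \in restr h.-1 t) q (nb_children t u))%:E.

(* Here [ln 0 = 0], whence 0 log 0 = 0. *)
Definition LlogL (P : probability (tree_space 0) R) : Prop :=
  'E_P[fun tau : tree 0 =>
    ((gen_size 1 tau)%:R * ln (gen_size 1 tau)%:R)%R] < +oo.

Definition is_limit_W (mu : R) (P : probability (tree_space 0) R)
    (W : {RV P >-> R}) : Prop :=
  {ae P, forall tau : tree_space 0,
    (fun n : nat => (gen_size n (tau : tree 0))%:R / mu ^+ n : R)%R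
      @ \oo --> (W tau : R)}.

Definition laplace (P : probability (tree_space 0) R) (W : {RV P >-> R})
    (b : R) : R :=
  fine 'E_P[fun tau => expR (- b * W tau)%R].

End GaltonWatson.

(* Derivative of a function on [0, +oo): two-sided in the interior, one-sided
   at 0. *)
Definition deriv_nneg {R : realType} (f : R -> R) (x : R) : R :=
  lim ((fun y : R => (f y - f x) / (y - x)) @ within [set y : R | 0 <= y] x^').

Definition deriven_nneg {R : realType} (k : nat) (f : R -> R) : R -> R :=
  iter k deriv_nneg f.

(** * The change of measure *)

Section ChangeOfMeasure.
Context {R : realType}.
Variables (phi : R -> R) (a mu : R).

(* phi^(l)(a / mu^n) *)
Definition phid (l n : nat) : R := deriven_nneg l phi (a / mu ^+ n).

Definition Hpoly (k : nat) (x : R) : R := (\prod_(j < k) (x - j%:R)) / k`!%:R.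

(* S_{i,p}; a positive integer occurring in a composition of p is at most p. *)
Definition compositions (i p : nat) : {set {ffun 'I_i -> 'I_p.+1}} :=
  [set s : {ffun 'I_i -> 'I_p.+1} |
     [forall r, (0 < s r)%N] && (\sum_(r < i) s r == p)%N].

Definition acoef (i p n : nat) : R :=
  \sum_(s in compositions i p) \prod_(r < i) (phid (s r) n / (s r)`!%:R).

Definition Gfun (p n n0 : nat) (x : R) : R :=
  if p is 0%N then (phid 0 n `^ x) / phid 0 n0
  else p`!%:R / phid p n0 *
       \sum_(1 <= i < p.+1) acoef i p n * Hpoly i x * phid 0 n `^ (x - i%:R).

Definition Mart (p n n0 : nat) (tau : tree n0) : R :=
  (mu ^+ (p * (n - n0)))^-1 * Gfun p n n0 (gen_size n tau)%:R.

Definition is_change_of_measure (p n0 : nat)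
    (P Q : probability (tree_space n0) R) : Prop :=
  forall n : nat, (n0 <= n)%N -> forall A : set (tree n0), filtr n0 n A ->
    Q A = (\int[P]_(tau in A) (Mart p n tau)%:E)%E.

End ChangeOfMeasure.

(** * The multi-type Galton-Watson tree *)

(* [type_of] takes arbitrary values on the words which are not nodes of the
   tree: no measurable event depends on these values. *)
Record typed_tree (k p : nat) := TypedTree {
  forget : tree k;
  type_of : word -> 'I_p.+1 }.

HB.instance Definition _ (k p : nat) := gen_eqMixin (typed_tree k p).
HB.instance Definition _ (k p : nat) := gen_choiceMixin (typed_tree k p).
HB.instance Definition _ (k p : nat) :=
  isPointed.Build (typed_tree k p) (TypedTree (root_tree k) (fun=> ord0)).

(* The event that the typed tree, truncated at height h, is (t, e). *)
Definition typed_event (k p h : nat) (t : tree k) (e : word -> 'I_p.+1) :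
    set (typed_tree k p) :=
  [set s | restr h (forget s) = t /\ forall u, nodes t u -> type_of s u = e u].

Definition all_typed_events (k p : nat) : set_system (typed_tree k p) :=
  [set A | exists (h : nat) (t : tree k) (e : word -> 'I_p.+1),
     height_le h t /\ A = typed_event h t e].

Notation typed_tree_space k p := (g_sigma_algebraType (@all_typed_events k p)).

Section MultiType.
Context {R : realType}.
Variables (q : nat -> R) (phi : R -> R) (a mu : R).

(* Probability that a node of type l at height n has [size ls] offspring, whose
   types are, in order, the entries of ls. *)
Definition type_trans (n l : nat) (ls : seq nat) : R :=
  if sumn ls == l then
    q (size ls) * (mu ^+ l)^-1 * (l`!%:R / phid phi a mu l n) *
    \prod_(lj <- ls) (phid phi a mu lj n.+1 / lj`!%:R)
  else 0.

Definition children_types (p : nat) (t : set word) (e : word -> 'I_p.+1)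
    (u : word) : seq nat :=
  [seq (e (rcons u i) : nat) | i <- iota 1 (nb_children t u)].

(* The root has type p and the nodes reproduce independently of each other. *)
Definition is_multitype_GW (p n0 : nat)
    (P : probability (typed_tree_space n0 p) R) : Prop :=
  forall (h : nat) (t : tree n0) (e : word -> 'I_p.+1),
    (n0 < h)%N -> height_le h t ->
    P (typed_event h t e) =
    (((e (ones n0) == p :> nat)%:R *
      \big[*%R/1]_(u \in restr h.-1 t)
        type_trans (size u) (e u) (children_types t e u))%:E)%E.

Definition is_multitype_tree_law (p n0 : nat)
    (Q : probability (tree_space n0) R) : Prop :=
  exists2 P : probability (typed_tree_space n0 p) R,
    is_multitype_GW P &
    forall A : set (tree_space n0), measurable A ->
      Q A = P [set s : typed_tree n0 p | A (forget s)].

End MultiType.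

(* Main.v *)
Require Import Defs.
From mathcomp Require Import all_boot all_order all_algebra.
From mathcomp Require Import finmap.
From mathcomp Require Import all_classical all_reals all_analysis measurable_realfun.
From mathcomp Require Import ring lra zify.

Set Implicit Arguments.
Unset Strict Implicit.
Unset Printing Implicit Defensive.

Import Order.TTheory GRing.Theory Num.Theory.
Import numFieldNormedType.Exports.

Local Open Scope classical_set_scope.
Local Open Scope ring_scope.

(** The events {r_h(tau) = t}, together with the empty set, form a pi-system
    which generates the sigma-algebra on trees, so it is enough to compare the
    two laws on these events, for h > n0 ([tree_law_unique]).

    On such an event the martingale is constant, and the change of measure gives
    M_h(t) prod_u q_(k_u) ([martingale_trunc_event]). For the multi-type tree,
    the probability of the event is the sum over the finitely many assignments
    of types to the nodes of t ([multitype_trunc_event]); only those for which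
    each node below height h has as type the sum of the types of its children
    contribute. Give a node of type l at height n the weight
    w(u) = phi^(l)(a / mu^n) / (l! mu^(l n)). Because the types of the children
    add up to l, the factor mu^(-l) of the transition probability is absorbed by
    the weights, and this probability equals q_k w(u)^(-1) prod_v w(v), where v
    runs over the children of u ([type_trans_inner]). The product over all nodes
    therefore telescopes, and only the weights of the root and of the nodes at
    height h remain ([prod_telescope]). An admissible assignment is determined
    by the types of the nodes at height h, which are arbitrary up to having sum
    p ([sum_consistent]). What is left is the sum, over all families of types of
    sum p, of the products of the phi^(l_v)(a / mu^h) / l_v!, that is the
    coefficient of X^p in (sum_l phi^(l)(a / mu^h) / l! X^l)^(Z_h). Splitting off
    the term l = 0 by the binomial formula identifies it with the function G
    that defines the martingale ([Gfun_sum]).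

    The telescoping divides by phi^(l)(a / mu^n) for l <= p, and these numbers
    must be nonzero. The martingale has 1 / phi^(p)(a / mu^n0) as a factor, so
    if phi^(p)(a / mu^n0) were 0, where 1 / 0 = 0, the measure obtained from it
    would be null rather than a probability ([phid_root_neq0]). This single fact
    propagates to the other derivatives ([deriven_laplace_neq0]): for b > 0,
    phi^(l)(b) = (-1)^l E[W^l e^(-bW)] can only vanish if l > 0 and W = 0 almost
    surely, in which case phi is constant; and at b = 0 a nonzero derivative of
    order l + 1 makes phi^(l) continuous there, while |phi^(l)| is bounded below
    by E[W^l e^(-W)] on (0, 1]. *)

(** * Derivatives on the half-line *)

Section OneSidedDerivative.
Context {R : realType}.
Implicit Types (f g : R -> R) (x b : R).

Lemma proper_within_nneg x : 0 <= x ->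
  ProperFilter (within [set y : R | 0 <= y] x^').
Proof.
move=> x0; split; last exact: within_filter.
move=> [e /= e0 /(_ (x + e / 2))] /=; apply.
- rewrite /ball /= opprD addNKr normrN gtr0_norm ?divr_gt0//.
  by rewrite ltr_pdivrMr// ltr_pMr// ltr1n.
- by rewrite eq_sym -subr_eq0 opprD addNKr oppr_eq0 mulf_neq0 ?gt_eqF.
- by rewrite addr_ge0// divr_ge0// ltW.
Qed.

Lemma deriv_nneg_eq f x l : 0 <= x ->
  (f y - f x) / (y - x) @[y --> within [set y : R | 0 <= y] x^'] --> l ->
  deriv_nneg f x = l.
Proof.
move=> x0 fl; have Fp := proper_within_nneg x0.
exact: cvg_lim fl.
Qed.

Lemma deriv_nneg_const f c x :
  (forall y, 0 <= y -> f y = c) -> 0 <= x -> deriv_nneg f x = 0.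
Proof.
move=> fc x0; apply: deriv_nneg_eq => //.
apply: cvg_near_cst.
rewrite near_withinE; near=> y => /= y0.
by rewrite !fc// subrr mul0r.
Unshelve. all: by end_near. Qed.

Lemma deriv_nneg_pos f g x : 0 < x -> (forall y, 0 < y -> f y = g y) ->
  derivable g x 1 -> deriv_nneg f x = derive1 g x.
Proof.
move=> x0 fg gx; apply: deriv_nneg_eq; first exact: ltW.
have : h^-1 *: (g (h + x) - g x) @[h --> 0^'] --> derive1 g x.
  rewrite derive1E /derive; under eq_fun do rewrite -[X in g (X + _)]scaler1.
  move/cvg_ex : gx => [l gl]; exact/cvgP/gl.
move=> /cvgrPdist_le H; apply/cvgrPdist_le => /= e e0.
have [r /= r0 Hr] := H _ e0.
have rx0 : 0 < Num.min r x by rewrite lt_min r0 x0.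
rewrite near_withinE; exists (Num.min r x) => //= y xy yx _.
have y0 : 0 < y.
  move: xy; rewrite /ball_ /= lt_min => /andP[_]; rewrite ltr_norml; lra.
have yxr : ball_ (fun z : R => `|z|) 0 r (y - x).
  move: xy; rewrite /ball_ /= lt_min => /andP[+ _].
  by rewrite sub0r normrN distrC.
have := Hr (y - x) yxr; rewrite subr_eq0 subrK => /(_ yx).
by rewrite !fg// [(g y - _) * _]mulrC.
Qed.

(** The limit of a divergent filter is 0 in R, so a nonzero value of
    [deriv_nneg] is a genuine derivative, and differentiability gives
    continuity. *)
Lemma cvg_deriv_nneg_neq0 f x : 0 <= x -> deriv_nneg f x != 0 ->
  f y @[y --> within [set y : R | 0 <= y] x^'] --> f x.
Proof.
move=> x0 fx.
have Fp := proper_within_nneg x0.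
have : cvg ((f y - f x) / (y - x) @[y --> within [set y : R | 0 <= y] x^']).
  by apply: contrapT => /dvgP; move: fx; rewrite /deriv_nneg => /eqP.
set F := within _ _ in Fp *.
move=> /cvg_ex[l fl].
have yx : y - x @[y --> F] --> (0 : R).
  rewrite -(subrr x); apply: cvgB; last exact: cvg_cst.
  by apply: cvg_within_filter; exact: nbhs_dnbhs.
have : (f y - f x) / (y - x) * (y - x) + f x @[y --> F] --> l * 0 + f x.
  by apply: cvgD; [exact: cvgM fl yx|exact: cvg_cst].
rewrite mulr0 add0r; apply: cvg_trans; apply: near_eq_cvg.
rewrite near_withinE; exists 1 => //= y _ yx0 _.
by rewrite divfK ?subr_eq0// subrK.
Qed.

End OneSidedDerivative.

(** * Derivatives of a Laplace transform *)

Section LaplaceMoments.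
Context d (T : measurableType d) (R : realType) (P : probability T R).
Variable V : T -> R.
Hypothesis mV : measurable_fun setT V.
Hypothesis V_ge0 : forall x, 0 <= V x.

Definition lmoment (l : nat) (b : R) : R :=
  \int[P]_x (V x ^+ l * expR (- b * V x)).

(** One term of the exponential series bounds the exponential: this gives a
    bound that is uniform in v and nonincreasing in b, as needed both for
    integrability and for domination. *)
Lemma expRN_pow_le (l : nat) (b v : R) : 0 < b -> 0 <= v ->
  v ^+ l * expR (- b * v) <= l`!%:R / b ^+ l.
Proof.
move=> b0 v0.
rewrite mulNr expRN ler_pdivrMr ?expR_gt0// mulrAC ler_pdivlMr ?exprn_gt0//.
rewrite -exprMn [v * b]mulrC [_ * expR _]mulrC -ler_pdivrMr ?ltr0n ?fact_gt0//.
case: l => [|l].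
  by rewrite expr0 fact0 mulr1n divr1 -expR0 ler_expR mulr_ge0// ltW.
apply: le_trans (expR_ge1Dxn l _); last by rewrite mulr_ge0// ltW.
by rewrite lerDr.
Qed.

Lemma measurable_lmoment l b :
  measurable_fun setT (fun x => V x ^+ l * expR (- b * V x)).
Proof.
apply: measurable_funM; first exact: measurable_funX.
by apply: measurableT_comp => //; exact: measurable_funM.
Qed.

Lemma integrable_lmoment l b : 0 < b \/ (l = 0%N /\ 0 <= b) ->
  P.-integrable setT (EFin \o (fun x => V x ^+ l * expR (- b * V x))).
Proof.
move=> lb; apply: measurable_bounded_integrable => //.
- exact: le_lt_trans (probability_le1 P measurableT) (ltry _).
- exact: measurable_lmoment.
- exists (l`!%:R / b ^+ l); split; first exact: num_real.
  move=> M lM x _ /=.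
  rewrite ger0_norm ?mulr_ge0 ?exprn_ge0 ?expR_ge0//.
  case: lb => [b0|[l0 b0]].
    by apply: le_trans (ltW lM); exact: expRN_pow_le.
  move: lM; rewrite l0 !expr0 fact0 mulr1n divr1 mul1r => /ltW; apply: le_trans.
  by rewrite -expR0 ler_expR mulNr oppr_le0 mulr_ge0.
Qed.

Lemma is_derive_lmoment (l : nat) (b v : R) :
  is_derive b 1 (fun b : R => v ^+ l * expR (- b * v))
    (- (v ^+ l.+1 * expR (- b * v))).
Proof.
apply: is_derive_eq.
by rewrite /= scaler0 add0r /GRing.scale /= exprS; ring.
Qed.

(** Differentiation under the expectation; on the interval from b / 2 to 2 b
    the derivative is dominated by the constant of [expRN_pow_le] at b / 2. *)
Lemma lmoment_derivative (l : nat) (b : R) : 0 < b ->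
  derivable (lmoment l) b 1 /\ derive1 (lmoment l) b = - lmoment l.+1 b.
Proof.
move=> b0.
pose f b x := V x ^+ l * expR (- b * V x) : R.
have d1f (b' : R) x : derive1 (f^~ x) b' = - (V x ^+ l.+1 * expR (- b' * V x)).
  by rewrite derive1E; have [] := is_derive_lmoment l b' (V x).
have b2 : 0 < b / 2 by rewrite divr_gt0.
have Ib : `]b / 2, b * 2[%classic b.
  rewrite /= in_itv /=; apply/andP; split; lra.
have If x : `]b / 2, b * 2[%classic x -> 0 < x.
  by rewrite /= in_itv /= => /andP[+ _]; exact: lt_trans.
pose G (x : T) : R := l.+1`!%:R / (b / 2) ^+ l.+1.
have intf x : `]b / 2, b * 2[%classic x -> P.-integrable setT (EFin \o f x).
  by move=> /If x0; apply: integrable_lmoment; left.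
have derf x y : `]b / 2, b * 2[%classic x -> setT y -> derivable (f ^~ y) x 1.
  by move=> _ _; have [] := is_derive_lmoment l x (V y).
have G0 y : 0 <= G y by rewrite divr_ge0// exprn_ge0// ltW.
have intG : P.-integrable setT (EFin \o G).
  exact: finite_measure_integrable_cst.
have Gub x y : `]b / 2, b * 2[%classic x -> setT y ->
    `|partial1of2 f x y| <= G y.
  rewrite /= in_itv /= => /andP[bx _] _.
  rewrite /partial1of2 d1f normrN ger0_norm ?mulr_ge0 ?exprn_ge0 ?expR_ge0//.
  apply: le_trans (expRN_pow_le l.+1 b2 (V_ge0 y)).
  rewrite ler_wpM2l ?exprn_ge0// ler_expR !mulNr lerN2 ler_wpM2r//.
  exact: ltW.
split.
  exact: (@derivable_under_integral _ _ _ P f setT measurableT b _ _ Ib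
    intf derf G G0 intG Gub).
have := @differentiation_under_integral _ _ _ P f setT measurableT b _ _ Ib
  intf derf G G0 intG Gub.
rewrite -/(lmoment l) => ->.
rewrite /partial1of2; under eq_Rintegral do rewrite d1f -mulN1r.
by rewrite RintegralZl ?mulN1r//; apply: integrable_lmoment; left.
Qed.

Lemma deriven_laplace_pos (phi : R -> R) : (forall b, phi b = lmoment 0 b) ->
  forall l b, 0 < b -> deriven_nneg l phi b = (-1) ^+ l * lmoment l b.
Proof.
move=> phiE; elim=> [|l IH] b b0; first by rewrite /= phiE mul1r.
have [dl dlE] := lmoment_derivative l b0.
have dZ : derivable (fun b => (-1) ^+ l * lmoment l b) b 1.
  exact: derivableZ.
rewrite /= (deriv_nneg_pos b0 IH dZ) derive1E deriveZ//.
by rewrite -derive1E dlE /GRing.scale /= mulrN exprS mulN1r mulNr.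
Qed.

(** A nonnegative function of integral 0 is 0 almost everywhere, and the
    exponential factor never vanishes. *)
Lemma lmoment_gt0 l b : 0 < b \/ (l = 0%N /\ 0 <= b) ->
  l = 0%N \/ ~ {ae P, forall x, V x = 0} -> 0 < lmoment l b.
Proof.
move=> lb nV.
rewrite lt_neqAle Rintegral_ge0 ?andbT; last first.
  by move=> x _; rewrite mulr_ge0 ?exprn_ge0 ?expR_ge0.
apply/eqP => /esym m0.
have : (\int[P]_x `|(V x ^+ l * expR (- b * V x))%:E| = 0)%E.
  under eq_integral do rewrite gee0_abs ?lee_fin ?mulr_ge0 ?exprn_ge0 ?expR_ge0//.
  rewrite -[LHS]fineK; first by rewrite -/(Rintegral _ _ _) [X in X%:E]m0.
  by apply: integrable_fin_num => //; exact: integrable_lmoment.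
move/ae_eq_integral_abs => /(_ measurableT).
have /measurable_EFinP mm := measurable_lmoment l b.
move=> /(_ mm) H.
have {}H : {ae P, forall x, V x ^+ l = 0}.
  apply: filterS H => x /(_ Logic.I) [/eqP].
  by rewrite mulf_eq0 expR_eq0 orbF => /eqP.
case: l lb nV m0 mm H => [|l] lb nV _ _ H.
  have muT : (0 < P [set: T])%E by rewrite probability_setT.
  have Pp := ae_properfilter_algebraOfSetsType muT.
  by have [x] := filter_ex H; rewrite expr0 => /eqP; rewrite oner_eq0.
case: nV => // nV; apply: nV; apply: filterS H => x /eqP.
by rewrite expf_eq0 => /andP[_ /eqP].
Qed.

Lemma lmoment_le l y z : 0 < y <= z -> lmoment l z <= lmoment l y.
Proof.
move=> /andP[y0 yz]; apply: le_Rintegral => //.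
- by apply: integrable_lmoment; left; exact: lt_le_trans yz.
- by apply: integrable_lmoment; left.
move=> x _; rewrite ler_wpM2l ?exprn_ge0// ler_expR !mulNr lerN2.
by rewrite ler_wpM2r.
Qed.

Lemma deriven_laplace_ae0 (phi : R -> R) : (forall b, phi b = lmoment 0 b) ->
  {ae P, forall x, V x = 0} ->
  forall l b, (0 < l)%N -> 0 <= b -> deriven_nneg l phi b = 0.
Proof.
move=> phiE aeV.
have phi1 b : phi b = 1.
  rewrite phiE /lmoment.
  rewrite /Rintegral (@ae_eq_integral _ _ _ P setT (cst 1%E))//.
  - rewrite integral_cst// mul1e; exact: (congr1 fine (probability_setT P)).
  - by apply/measurable_EFinP; exact: measurable_lmoment.
  - by apply: filterS aeV => x -> _; rewrite /= mulr0 expR0 expr0 mulr1.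
suff H l b : 0 <= b -> deriven_nneg l.+1 phi b = 0 by case=> // l b _; exact: H.
elim: l b => [|l IH] b b0 /=; first exact: (@deriv_nneg_const _ _ 1).
exact: (@deriv_nneg_const _ _ 0).
Qed.

(** A nonzero derivative of order p excludes V = 0 almost everywhere (unless
    p = 0), so that all derivatives are nonzero on the open half-line. At the
    boundary point the moments may be infinite, and one goes down from p one
    order at a time: as the derivative of order k + 1 is nonzero there, the one
    of order k is the limit of its values at y > 0, whose absolute values are
    at least [lmoment k 1] for y <= 1. *)
Lemma deriven_laplace_neq0 (phi : R -> R) : (forall b, phi b = lmoment 0 b) ->
  forall p c0, 0 <= c0 -> deriven_nneg p phi c0 != 0 ->
  forall l c, (l <= p)%N -> (0 < c) || (c == c0) -> deriven_nneg l phi c != 0.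
Proof.
move=> phiE p c0 c0_ge0 pc0 l c lp cc0.
have nV : l = 0%N \/ ~ {ae P, forall x, V x = 0}.
  case: l lp => [|l] lp; [by left|right => aeV].
  move/eqP: pc0; apply; apply: (deriven_laplace_ae0 phiE aeV) => //.
  exact: leq_ltn_trans lp.
have [c_gt0|c_le0] := ltP 0 c.
  rewrite (deriven_laplace_pos phiE)// mulf_neq0 ?signr_eq0//.
  by rewrite gt_eqF// lmoment_gt0//; left.
move: cc0; rewrite ltNge c_le0 /= => /eqP cE; rewrite cE in c_le0 *.
have {c_le0 cE c} c0E : c0 = 0 by apply/eqP; rewrite eq_le c0_ge0 c_le0.
rewrite {c0 c0_ge0}c0E in pc0 *.
have [->//|lp'] := eqVneq l p.
have {lp lp'} lp : (l < p)%N by rewrite ltn_neqAle lp' lp.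
have nVT : ~ {ae P, forall x, V x = 0}.
  move=> aeV; move/eqP: pc0; apply.
  by apply: (deriven_laplace_ae0 phiE aeV) => //; exact: leq_ltn_trans lp.
elim: p pc0 lp => // p IH pc0; rewrite ltnS => lp.
suff pp : deriven_nneg p phi 0 != 0.
  by move: lp; rewrite leq_eqVlt => /predU1P[->//|]; exact: IH.
have := cvg_deriv_nneg_neq0 (lexx 0) pc0.
set F := within _ _ => Fc.
have Fp : ProperFilter F := proper_within_nneg (lexx 0).
have : `|deriven_nneg p phi y| @[y --> F] --> `|deriven_nneg p phi 0|.
  exact: cvg_norm.
move=> /cvgr_to_ge H.
rewrite -normr_gt0.
apply: (@lt_le_trans _ _ (lmoment p 1)); first by apply: lmoment_gt0; [left|right].
apply: H; rewrite near_withinE; exists 1 => //= y y1 yN0 y0.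
have {yN0}y0 : 0 < y by rewrite lt_neqAle eq_sym yN0.
rewrite (deriven_laplace_pos phiE)// normrMsign.
have -> : `|lmoment p y| = lmoment p y.
  by rewrite ger0_norm// ltW// lmoment_gt0//; [left|right].
apply: lmoment_le; rewrite y0 /=.
by move: y1; rewrite /ball_ /= sub0r normrN gtr0_norm// => /ltW.
Qed.

End LaplaceMoments.

(** * The function G as a coefficient *)

Section CoefficientExtraction.

Lemma coef_exp_poly (R : comNzRingType) (I : finType) (p : nat) (c : nat -> R) :
  ((\poly_(l < p.+1) c l) ^+ #|I|)`_p =
  \sum_(f : {ffun I -> 'I_p.+1} | (\sum_i f i == p)%N) \prod_i c (f i).
Proof.
rewrite -prodr_const poly_def.
rewrite (bigA_distr_bigA (fun (_ : I) (l : 'I_p.+1) => c l *: 'X^l)) /= coef_sum.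
rewrite [RHS]big_mkcond /=; apply: eq_bigr => f _.
rewrite scaler_prod -expr_sum coefZ coefXn eq_sym.
by case: eqP; rewrite ?mulr1 ?mulr0.
Qed.

Lemma Hpoly_bin (R : realType) (i z : nat) : Hpoly i (z%:R : R) = 'C(z, i)%:R.
Proof.
rewrite /Hpoly; apply: (@mulIf _ i`!%:R); first by rewrite pnatr_eq0 -lt0n fact_gt0.
rewrite divfK ?pnatr_eq0 -?lt0n ?fact_gt0// -natrM bin_ffact.
elim: i => [|i IH]; first by rewrite big_ord0.
rewrite big_ord_recr /= IH ffactnSr natrM.
have [iz|zi] := leqP i z; first by rewrite natrB.
by rewrite ffact_small// !mul0r.
Qed.

Context {R : realType}.
Variables (phi : R -> R) (a mu : R).

(** Compositions of p into i positive parts are the choices of i exponents of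
    sum p in a power of a polynomial without constant term. *)
Lemma acoef_coef (p n i : nat) :
  acoef phi a mu i p n =
  ((\poly_(l < p.+1) (if l == 0%N then 0 else phid phi a mu l n / l`!%:R)) ^+ i)`_p.
Proof.
rewrite -[i in RHS]card_ord coef_exp_poly /acoef.
rewrite big_mkcond [RHS]big_mkcond /=; apply: eq_bigr => s _; rewrite inE andbC.
case: eqP => //= sp; case: ifPn => [/forallP s0|].
  by apply: eq_bigr => r _; rewrite -if_neg -lt0n s0.
rewrite negb_forall => /existsP[r]; rewrite -eqn0Ngt => /eqP sr.
by rewrite (bigD1 r)//= sr mul0r.
Qed.

Lemma acoef_gt (p n i : nat) : (p < i)%N -> acoef phi a mu i p n = 0.
Proof.
move=> pi; rewrite /acoef big_pred0// => s; rewrite inE.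
apply/negP => /andP[/forallP s0 /eqP sp].
have : (\sum_(r < i) 1 <= \sum_(r < i) s r)%N by exact: leq_sum.
by rewrite sum1_card card_ord sp leqNgt pi.
Qed.

Lemma acoef0 (p n : nat) : (0 < p)%N -> acoef phi a mu 0 p n = 0.
Proof. by move=> p0; rewrite acoef_coef expr0 coef1 gtn_eqF. Qed.

(** Both sides are the coefficient of X^p in the power #|I| of the polynomial
    c_0 + B, where B has no constant term and its powers have the numbers
    [acoef] as coefficients. The binomial formula runs over i <= #|I| and
    [Gfun] over 1 <= i <= p: the binomial coefficient vanishes for i > #|I|,
    and [acoef] for i = 0 and for i > p. *)
Lemma Gfun_sum (I : finType) (p n n0 : nat) : 0 < phid phi a mu 0 n ->
  Gfun phi a mu p n n0 #|I|%:R =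
  p`!%:R / phid phi a mu p n0 *
  \sum_(f : {ffun I -> 'I_p.+1} | (\sum_i f i == p)%N)
     \prod_i (phid phi a mu (f i) n / (f i)`!%:R).
Proof.
move=> phi0; set z := #|I|.
rewrite -(coef_exp_poly I p (fun l => phid phi a mu l n / l`!%:R)) -/z.
case: p => [|p].
  rewrite /Gfun powR_mulrn 1?ltW// poly_def big_ord1 -/z expr0 alg_polyC -rmorphXn /=.
  by rewrite coefC eqxx fact0 divr1 mulrC mul1r.
rewrite /Gfun; congr (_ * _).
set B := \poly_(l < p.+2) (if l == 0%N then 0 else phid phi a mu l n / l`!%:R).
have -> : \poly_(l < p.+2) (phid phi a mu l n / l`!%:R) = (phid phi a mu 0 n)%:P + B.
  apply/polyP => l; rewrite coefD coefC !coef_poly.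
  by case: l => [|l] /=; rewrite ?fact0 ?divr1 ?addr0 ?add0r.
rewrite exprDn coef_sum.
(* The summand extended to all i, so that both sums can be compared with one
   over a common range. *)
pose F i := acoef phi a mu i p.+1 n * 'C(z, i)%:R * phid phi a mu 0 n ^+ (z - i).
transitivity (\sum_(0 <= i < (z + p.+1).+1) F i).
  rewrite [RHS](@big_cat_nat _ _ _ p.+2)//= ?ltnS ?leq_addl//.
  rewrite [X in _ = _ + X]big_nat_cond [X in _ = _ + X]big1 ?addr0; last first.
    by move=> i /andP[/andP[pi _] _]; rewrite /F acoef_gt ?mul0r.
  rewrite [RHS]big_nat_recl// /F acoef0// !mul0r add0r big_add1 /=.
  rewrite big_nat_cond [RHS]big_nat_cond; apply: eq_bigr => i _.
  rewrite Hpoly_bin; have [iz|zi] := leqP i.+1 z.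
    by rewrite -natrB// powR_mulrn 1?ltW.
  by rewrite bin_small// mulr0 !mul0r.
rewrite -addSn (@big_cat_nat _ _ _ z.+1)//= ?leq_addr// [X in _ + X]big_nat_cond.
rewrite [X in _ + X]big1 ?addr0; last first.
  by move=> i /andP[/andP[zi _] _]; rewrite /F bin_small// mulr0 mul0r.
rewrite big_mkord; apply: eq_bigr => i _.
rewrite /F acoef_coef -/B coefMn -rmorphXn /= coefCM -[RHS]mulr_natr.
by rewrite mulrAC; congr (_ * _); rewrite mulrC.
Qed.

End CoefficientExtraction.

(** * Nodes of a tree of bounded height *)

Section TreeFacts.
Variable k : nat.
Implicit Types (t : tree k) (u v : word).

Lemma tree_size_ge t v : nodes t v -> (k <= size v)%N.
Proof.
move=> tv; rewrite leqNgt; apply/negP => vk.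
by have [_ _ + _ _] := treeP t => /(_ v); rewrite size_nseq => /(_ vk).
Qed.

Lemma tree_root t : nodes t (ones k).
Proof. by have [] := treeP t. Qed.

Lemma tree_take t v m : nodes t v -> (k <= m)%N -> nodes t (take m v).
Proof.
move=> tv km; have [n] := ubnP (size v - m).
elim: n => // n IH in v tv *; rewrite ltnS => vn.
have [vm|mv] := leqP (size v) m; first by rewrite take_oversize.
have vk : v <> ones k.
  by move=> vE; move: mv; rewrite vE size_nseq ltnNge km.
have [_ _ _ /(_ v tv vk) tpv _] := treeP t.
have -> : take m v = take m (parent v) by rewrite /parent take_takel//; lia.
by apply: IH => //; rewrite size_takel ?leq_pred//; lia.
Qed.

Lemma tree_take_root t v : nodes t v -> take k v = ones k.
Proof.
move=> tv; have := tree_take tv (leqnn k).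
have : size (take k v) = k by rewrite size_takel// (tree_size_ge tv).
move: (take k v) => w wk tw; apply: contrapT => wr.
have [_ _ _ /(_ w tw wr) /tree_size_ge + _] := treeP t.
rewrite size_takel ?leq_pred// wk; have [k0 _|k0] := posnP k; last by lia.
by apply: wr; rewrite (size0nil (etrans wk k0)) k0.
Qed.

Lemma nb_childrenP t v i : nodes t v -> (0 < i)%N ->
  nodes t (rcons v i) <-> (i <= nb_children t v)%N.
Proof.
move=> tv i0; have [_ _ _ _ /(_ v tv) tk] := treeP t.
by have := @xgetPex nat 0%N _ tk => /(_ i i0).
Qed.

(** By induction on the height: each node has finitely many children. *)
Lemma finite_tree t h : height_le h t -> finite_set (nodes t).
Proof.
have fin m : finite_set (restr m t).
  elim: m => [|m IH].
    apply: sub_finite_set (finite_set1 [::]) => v [_].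
    by rewrite leqn0 size_eq0 => /eqP.
  pose B v := rcons v @` `I_(nb_children t v).+1.
  apply: (@sub_finite_set _ _ (restr m t `|` \bigcup_(v in restr m t) B v `|` [set ones k])).
    move=> v [tv vm].
    have [vs|ms] := leqP (size v) m; first by left; left.
    have [->|/eqP vk] := eqVneq v (ones k); first by right.
    left; right; have [pos _ _ /(_ v tv vk) tpv _] := treeP t.
    case/lastP: v tv vm ms vk tpv => // v i tv vm ms vk.
    rewrite /parent size_rcons /= -cats1 take_size_cat// => tpv.
    exists v; first by split=> //; move: vm; rewrite size_rcons ltnS.
    have i0 : (0 < i)%N by have := pos _ tv; rewrite all_rcons => /andP[].
    have ik : (i <= nb_children t v)%N by apply/(nb_childrenP tpv i0).
    by exists i => //; rewrite cats1.
  rewrite !finite_setU; split; last exact: finite_set1.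
  split=> //; apply: bigcup_finite => // v _; apply: finite_image.
  exact: finite_II.
by move=> th; apply: sub_finite_set (fin h) => v tv; split=> //; exact: th.
Qed.

End TreeFacts.

(** * Sums and products over the nodes *)

Section NodeSums.
Variables (n0 h : nat) (t : tree n0).
Hypothesis th : height_le h t.

Definition node_fset : {fset word} := fset_set (nodes t).
Notation D := node_fset.

Lemma node_fsetP v : reflect (nodes t v) (v \in D).
Proof.
rewrite (in_fset_set (finite_tree th)).
by apply: (iffP idP) => [/set_mem|/mem_set].
Qed.

Lemma node_size v : v \in D -> (n0 <= size v <= h)%N.
Proof. by move=> /node_fsetP tv; rewrite (tree_size_ge tv) th. Qed.

Lemma node_take v m : v \in D -> (n0 <= m)%N -> take m v \in D.
Proof. by move=> /node_fsetP tv nm; apply/node_fsetP/tree_take. Qed.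

Lemma node_take_root v : v \in D -> take n0 v = ones n0.
Proof. by move=> /node_fsetP; exact: tree_take_root. Qed.

Lemma node_root : ones n0 \in D.
Proof. exact/node_fsetP/tree_root. Qed.

Implicit Types (u v w : D) (m : nat).

Definition anc u v := take (size (val u)) (val v) == val u.
Definition child u v := anc u v && (size (val v) == (size (val u)).+1).
(** Nodes are classified by their height alone: a childless node below height
    [h] is [inner], and a [leaf] is a node whose children are cut off by the
    truncation. *)
Definition inner u := (size (val u) < h)%N.
Definition leaf u := size (val u) == h.
Definition rootn : D := FSetSub node_root.
(** The ancestor of [v] at height [m], meaningful for [n0 <= m]: the default
    value is then never reached, as the tree is closed under such prefixes. *)
Definition anc_at m v : D := insubd rootn (take m (val v)).

Lemma sizeD v : (n0 <= size (val v) <= h)%N.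
Proof. exact/node_size/valP. Qed.

Lemma val_anc_at m v : (n0 <= m)%N -> val (anc_at m v) = take m (val v).
Proof. by move=> nm; rewrite insubdK//; apply: node_take => //; exact: valP. Qed.

Lemma size_eq_root v : size (val v) = n0 -> v = rootn.
Proof.
move=> vn; apply: val_inj; rewrite /= -(node_take_root (valP v)).
by rewrite -vn take_size.
Qed.

Lemma anc_root v : anc rootn v.
Proof. by rewrite /anc /= size_nseq node_take_root// (valP v). Qed.

Lemma anc_leaf u v : leaf u -> leaf v -> anc u v = (v == u).
Proof.
move=> /eqP uh /eqP vh; rewrite /anc uh -vh take_size.
by rewrite (inj_eq val_inj).
Qed.

(** Each leaf descending from an inner node [u] descends from exactly one of
    its children, namely its own ancestor at the next height. *)
Lemma partition_child (R : Type) (idx : R) (op : Monoid.com_law idx) u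
    (F : D -> R) : inner u ->
  \big[op/idx]_(v | leaf v && anc u v) F v =
  \big[op/idx]_(w | child u w) \big[op/idx]_(v | leaf v && anc w v) F v.
Proof.
move=> ui; have /andP[nu _] := sizeD u.
have nu1 : (n0 <= (size (val u)).+1)%N by exact: leqW.
rewrite (partition_big (anc_at (size (val u)).+1) (child u)); last first.
  move=> v /andP[/eqP vh /eqP uv].
  rewrite /child /anc val_anc_at// take_takel// uv eqxx/=.
  by rewrite size_takel// vh.
apply: eq_bigr => w /andP[/eqP uw /eqP wu]; apply: eq_bigl => v.
rewrite -andbA; congr (_ && _).
rewrite /anc -(inj_eq val_inj) val_anc_at// wu.
apply/andP/idP => [[]//|/eqP vw].
split; last by rewrite vw.
by apply/eqP; rewrite -[RHS]uw -vw take_takel.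
Qed.

(** Iterating the conservation law of the children up to height [h]; the
    induction is on the distance to that height. *)
Lemma leaf_sum (S : nmodType) (E : D -> S) :
  (forall u, inner u -> E u = \sum_(w | child u w) E w) ->
  forall u, E u = \sum_(v | leaf v && anc u v) E v.
Proof.
move=> HE u; have [k] := ubnP (h - size (val u)).
elim: k => // k IH in u *; rewrite ltnS => uk.
have [ui|] := boolP (inner u); last first.
  rewrite -leqNgt => hu.
  have uh : leaf u by rewrite /leaf eqn_leq hu andbT; have /andP[] := sizeD u.
  rewrite (bigD1 u) /=; last by rewrite uh anc_leaf// eqxx.
  rewrite big1 ?addr0// => v /andP[/andP[vh]].
  by rewrite anc_leaf// => /eqP ->; rewrite eqxx.
rewrite partition_child// HE//; apply: eq_bigr => w uw; apply: IH.
by move: uw ui => /andP[_ /eqP ->]; rewrite /inner; lia.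
Qed.

Lemma innerE v : inner v = ~~ leaf v.
Proof. by rewrite /inner /leaf; have /andP[_] := sizeD v; rewrite leq_eqVlt; lia. Qed.

(** Each node other than the root is the child of exactly one inner node, so
    the weights W v of the children run over all nodes but the root. *)
Lemma prod_telescope (R : fieldType) (W : D -> R) : (n0 < h)%N ->
  (forall u, W u != 0) ->
  \prod_(u | inner u) ((W u)^-1 * \prod_(v | child u v) W v) =
  (W rootn)^-1 * \prod_(v | leaf v) W v.
Proof.
move=> nh W0; rewrite big_split /=.
have -> : \prod_(u | inner u) \prod_(v | child u v) W v =
          \prod_(v | v != rootn) W v.
  rewrite [RHS](partition_big (fun v => anc_at (size (val v)).-1 v) inner) /=.
    apply: eq_bigr => u ui; apply: eq_bigl => v.
    have /andP[nu _] := sizeD u; have /andP[nv vh] := sizeD v.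
    have [->|vr] /= := eqVneq v rootn.
      by rewrite /child [val rootn]/= size_nseq [n0 == _]ltn_eqF ?andbF.
    have {}nv : (n0 < size (val v))%N.
      by rewrite ltn_neqAle nv andbT; apply: contra_neq vr => /esym/size_eq_root.
    have vE := ltn_predK nv.
    rewrite -(inj_eq val_inj) val_anc_at; last by rewrite -ltnS vE.
    apply/andP/eqP => [[/eqP uv /eqP vu]|uv]; first by rewrite vu.
    have su : size (val u) = (size (val v)).-1.
      by rewrite -uv size_takel ?leq_pred.
    by rewrite /anc su uv eqxx vE eqxx.
  move=> v vr; have /andP[nv vh] := sizeD v.
  have {}nv : (n0 < size (val v))%N.
    by rewrite ltn_neqAle nv andbT; apply: contra_neq vr => /esym/size_eq_root.
  have vE := ltn_predK nv.
  rewrite /inner val_anc_at; last by rewrite -ltnS vE.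
  by rewrite size_takel ?leq_pred// vE.
have H : W rootn * \prod_(v | v != rootn) W v =
    \prod_(u | inner u) W u * \prod_(v | leaf v) W v.
  transitivity (\prod_v W v); first by rewrite [RHS](bigD1 rootn).
  rewrite (bigID inner) /=; congr (_ * _); apply: eq_bigl => v.
  by rewrite innerE negbK.
rewrite prodfV.
apply: (mulfI (W0 rootn)); rewrite mulrCA H mulVKf// ?mulKf//.
by rewrite prodf_seq_neq0; apply/allP => u _; apply/implyP.
Qed.

Definition leaves := {v : D | leaf v}.

(** The condition under which no transition probability vanishes on account
    of the types. *)
Definition consistent p (e : {ffun D -> 'I_p.+1}) :=
  [forall u, inner u ==> (e u == \sum_(v | child u v) e v :> nat)%N].

Lemma big_leaves (R : Type) (idx : R) (op : Monoid.com_law idx) (P : pred D)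
    (F : D -> R) :
  \big[op/idx]_(v | leaf v && P v) F v =
  \big[op/idx]_(v : leaves | P (val v)) F (val v).
Proof. exact: (big_sub_cond leaf P F). Qed.

Lemma consistent_leaves p (e : {ffun D -> 'I_p.+1}) u : consistent e ->
  e u = (\sum_(v : leaves | anc u (val v)) e (val v))%N :> nat.
Proof.
move=> /forallP He.
rewrite (@leaf_sum _ (fun v => e v : nat)); last first.
  by move=> w wi; have /implyP/(_ wi)/eqP := He w.
exact: big_leaves.
Qed.

(** Restriction to the leaves is a bijection from the consistent assignments
    with root of type p to the families of leaf types of sum p. Its inverse
    gives a node the sum of the types of the leaves descending from it. *)
Lemma sum_consistent (R : nmodType) (p : nat) (F : {ffun leaves -> 'I_p.+1} -> R) :
  \sum_(e : {ffun D -> 'I_p.+1} | (e rootn == p :> nat) && consistent e)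
     F [ffun v => e (val v)] =
  \sum_(f : {ffun leaves -> 'I_p.+1} | (\sum_v f v == p)%N) F f.
Proof.
pose restrict (e : {ffun D -> 'I_p.+1}) : {ffun leaves -> 'I_p.+1} :=
  [ffun v => e (val v)].
(* inord is applied to partial sums of a sum equal to p, hence to numbers that
   are at most p. *)
pose extend (f : {ffun leaves -> 'I_p.+1}) : {ffun D -> 'I_p.+1} :=
  [ffun u => inord (\sum_(v : leaves | anc u (val v)) f v)].
have anc_rootT (G : leaves -> nat) :
    (\sum_(v : leaves | anc rootn (val v)) G v = \sum_v G v)%N.
  by apply: eq_bigl => v; rewrite anc_root.
rewrite (reindex_onto extend restrict); last first.
  move=> e /andP[_ /consistent_leaves He]; apply/ffunP => u; rewrite ffunE.
  apply: val_inj; rewrite /= inordK.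
    by rewrite He; apply: eq_bigr => v _; rewrite ffunE.
  under eq_bigr do rewrite ffunE.
  by rewrite -He.
have HP f : [&& extend f rootn == p :> nat, consistent (extend f) &
    restrict (extend f) == f] = (\sum_v f v == p)%N.
  apply/and3P/eqP => [[/eqP rp cf /eqP rf]|fp].
    rewrite -[RHS]rp (consistent_leaves _ cf) anc_rootT -[in LHS]rf.
    by apply: eq_bigr => v _; rewrite ffunE.
  have extE u : extend f u = (\sum_(v : leaves | anc u (val v)) f v)%N :> nat.
    rewrite ffunE inordK// ltnS -[X in (_ <= X)%N]fp.
    by rewrite big_mkcond leq_sum// => v _; case: ifP.
  split; first by rewrite extE anc_rootT fp.
    apply/forallP => u; apply/implyP => ui; rewrite extE.
    (* f extended by 0 to all nodes, to apply partition_child. *)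
    pose G v := if insub v is Some w then f w : nat else 0%N.
    have GE u' : (\sum_(v : leaves | anc u' (val v)) f v =
                 \sum_(v | leaf v && anc u' v) G v)%N.
      by rewrite big_leaves; apply: eq_bigr => v _; rewrite /G valK.
    rewrite GE partition_child//; apply/eqP/eq_bigr => w _.
    by rewrite extE GE.
  apply/eqP/ffunP => v; rewrite ffunE; apply: val_inj; rewrite /= extE.
  rewrite (bigD1 v)/=; last by rewrite anc_leaf ?(valP v).
  rewrite big1 ?addn0// => w /andP[].
  by rewrite anc_leaf ?(valP v) ?(valP w)// (inj_eq val_inj) => /eqP ->; rewrite eqxx.
apply: eq_big => f; first by rewrite -andbA HP.
by rewrite -andbA HP; rewrite -HP => /and3P[_ _ /eqP]; rewrite /restrict => ->.
Qed.

(** Relates the children as nodes of the tree to their enumeration as words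
    u1, ..., uk, the form in which they occur in [children_types]. *)
Lemma big_children (R : Type) (idx : R) (op : Monoid.com_law idx) (u : D)
    (F : word -> R) :
  \big[op/idx]_(v : D | child u v) F (val v) =
  \big[op/idx]_(i <- iota 1 (nb_children t (val u))) F (rcons (val u) i).
Proof.
pose P (w : word) := (take (size (val u)) w == val u) &&
  (size w == (size (val u)).+1).
rewrite -(big_seq_fsetE op D P F) -big_filter.
rewrite -(big_map (rcons (val u)) xpredT F).
have tu : nodes t (val u) by apply/node_fsetP/valP.
apply: perm_big; apply: uniq_perm.
- by rewrite filter_uniq// fset_uniq.
- by rewrite map_inj_uniq ?iota_uniq//; apply: rcons_injr.
move=> w; rewrite mem_filter.
apply/andP/mapP => [[/andP[/eqP uw /eqP wu] /node_fsetP tw]|[i]]; last first.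
  rewrite mem_iota add1n ltnS => /andP[i0 ik] ->; split.
    by rewrite /P size_rcons eqxx -cats1 take_size_cat ?eqxx.
  by apply/node_fsetP/nb_childrenP.
case/lastP: w uw wu tw => // w i uw.
rewrite size_rcons => -[wu] tw.
have {}uw : w = val u by move: uw; rewrite -cats1 take_cat -wu ltnn subnn take0 cats0.
rewrite {}uw in tw *; exists i => //.
have i0 : (0 < i)%N.
  by have [/(_ _ tw) + _ _ _ _] := treeP t; rewrite all_rcons => /andP[].
by rewrite mem_iota i0 add1n ltnS /=; apply/(nb_childrenP tu i0).
Qed.

Lemma fsbig_inner (R : Type) (idx : R) (op : Monoid.com_law idx)
    (F : word -> R) : (n0 < h)%N ->
  \big[op/idx]_(u \in restr h.-1 t) F u = \big[op/idx]_(u : D | inner u) F (val u).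
Proof.
move=> nh; have ft := finite_tree th.
have fr : finite_set (restr h.-1 t) by apply: sub_finite_set ft => v [].
rewrite fsbig_finite//= -(big_seq_fsetE op D (fun x : word => size x < h)%N F) -[RHS]big_filter.
apply: perm_big; apply: uniq_perm; rewrite ?filter_uniq ?fset_uniq//.
move=> w; rewrite mem_filter in_fset_set//.
apply/idP/andP => [/set_mem[tw wh]|[wh /node_fsetP tw]].
  by split; [rewrite -(ltn_predK nh) ltnS|exact/node_fsetP].
by apply/mem_set; split=> //=; rewrite -ltnS (ltn_predK nh).
Qed.

Lemma card_leaves : #|{: leaves}| = gen_size h t.
Proof.
have ft := finite_tree th.
have fr : finite_set [set u | nodes t u /\ size u = h].
  by apply: sub_finite_set ft => v [].
rewrite card_sig -sum1_card.
rewrite -(big_seq_fsetE addn D (fun x : word => size x == h) (fun=> 1%N)).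
rewrite -big_filter sum1_size /gen_size.
apply/perm_size; apply: uniq_perm; rewrite ?filter_uniq ?fset_uniq//.
move=> w; rewrite mem_filter (in_fset_set fr).
apply/andP/idP => [[/eqP wh wD]|/set_mem[tw wh]].
  by apply/mem_set; split=> //; exact/node_fsetP.
by split; [exact/eqP|exact/node_fsetP].
Qed.

End NodeSums.

(** * The sum over all types *)

Section TypedTreeWeights.
Context {R : realType}.
Variables (q : nat -> R) (phi : R -> R) (a mu : R) (p n0 h : nat) (t : tree n0).
Hypotheses (mu_neq0 : mu != 0) (nh : (n0 < h)%N) (th : height_le h t).
Hypothesis phid_neq0 : forall l n, (l <= p)%N -> (n0 <= n)%N -> phid phi a mu l n != 0.
Hypothesis phid0_gt0 : 0 < phid phi a mu 0 h.

Notation D := (node_fset t).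
Notation root := (rootn th).

Definition extend_types (e : {ffun D -> 'I_p.+1}) (u : word) : 'I_p.+1 :=
  if insub u is Some v then e v else ord0.

Lemma extend_types_val e (v : D) : extend_types e (val v) = e v.
Proof. by rewrite /extend_types valK. Qed.

(** The power of mu depends on the height so that, when the types of the
    children add up to that of the parent, the ratio of the powers for the
    children and for the parent is mu to the minus type of the parent. *)
Definition weight (e : {ffun D -> 'I_p.+1}) (u : D) : R :=
  phid phi a mu (e u) (size (val u)) / (e u)`!%:R / mu ^+ (e u * size (val u)).

Lemma weight_neq0 e u : weight e u != 0.
Proof.
apply: mulf_neq0; last by rewrite invr_eq0 expf_neq0.
apply: mulf_neq0; last by rewrite invr_eq0 pnatr_eq0 -lt0n fact_gt0.
apply: phid_neq0; first by rewrite -ltnS.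
by have /andP[] := node_size th (valP u).
Qed.

Lemma sumn_children_types e (u : D) :
  sumn (children_types t (extend_types e) (val u)) =
  (\sum_(v : D | child u v) e v)%N.
Proof.
rewrite sumnE big_map -(big_children th _ u (fun w => extend_types e w : nat)).
by apply: eq_bigr => v _; rewrite extend_types_val.
Qed.

Lemma type_trans_inner e (u : D) : inner h u -> consistent h e ->
  type_trans q phi a mu (size (val u)) (extend_types e (val u))
    (children_types t (extend_types e) (val u)) =
  q (nb_children t (val u)) *
  ((weight e u)^-1 * \prod_(v : D | child u v) weight e v).
Proof.
move=> ui /forallP/(_ u); rewrite ui /= => /eqP eu.
rewrite /type_trans sumn_children_types extend_types_val -eu eqxx.
rewrite {1}/children_types size_map size_iota.
rewrite big_map -(big_children th _ u (fun w => phid phi a mu (extend_types e w)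
 (size (val u)).+1 / (extend_types e w)`!%:R)).
have -> : \prod_(v : D | child u v) (phid phi a mu (extend_types e (val v))
      (size (val u)).+1 / (extend_types e (val v))`!%:R) =
    \prod_(v : D | child u v) (phid phi a mu (e v) (size (val u)).+1 / (e v)`!%:R).
  by apply: eq_bigr => v _; rewrite extend_types_val.
have -> : \prod_(v : D | child u v) weight e v =
  \prod_(v : D | child u v) (phid phi a mu (e v) (size (val u)).+1 / (e v)`!%:R) /
  mu ^+ (e u * (size (val u)).+1).
  rewrite eu big_distrl /= expr_sum -prodfV -big_split /=.
  by apply: eq_bigr => v /andP[_ /eqP vu]; rewrite /weight vu.
rewrite -!mulrA; congr (_ * _).
rewrite {1}/weight mulnS exprD !invfM !invrK.
have m0 : mu ^+ (e u * size (val u)) != 0 by rewrite expf_neq0.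
have m1 : mu ^+ (e u) != 0 by rewrite expf_neq0.
set X := \prod_(_ | _) _.
have f0 : phid phi a mu (e u) (size (val u)) != 0.
  apply: phid_neq0; first by rewrite -ltnS.
  by have /andP[] := node_size th (valP u).
move: m0 m1 f0; move: (mu ^+ _) (mu ^+ _) (phid _ _ _ _ _) (_`!%:R) X.
by move=> M0 M1 P0 N X m0 m1 f0; field; rewrite m0 m1 f0.
Qed.

(** The left side is a sum over consistent assignments of a product that
    telescopes to a function of the leaf types; it is transported to a free sum
    over these by [sum_consistent] and evaluated by [Gfun_sum]. *)
Lemma sum_type_trans :
  \sum_(e : {ffun D -> 'I_p.+1})
     ((extend_types e (ones n0) == p :> nat)%:R *
      \prod_(u : D | inner h u)
        type_trans q phi a mu (size (val u)) (extend_types e (val u))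
          (children_types t (extend_types e) (val u))) =
  Mart phi a mu p h t * \prod_(u : D | inner h u) q (nb_children t (val u)).
Proof.
pose Q := \prod_(u : D | inner h u) q (nb_children t (val u)).
pose F (f : {ffun leaves h t -> 'I_p.+1}) : R :=
  Q * (phid phi a mu p n0 / p`!%:R / mu ^+ (p * n0))^-1 *
  (\prod_v (phid phi a mu (f v) h / (f v)`!%:R) / mu ^+ (p * h)).
transitivity (\sum_(e : {ffun D -> 'I_p.+1} | (e root == p :> nat) && consistent h e)
   F [ffun v => e (val v)]).
  rewrite [RHS]big_mkcond /=; apply: eq_bigr => e _.
  rewrite -[ones n0]/(val root) extend_types_val.
  have [rp|_] := eqVneq (e root : nat) p; last by rewrite mul0r.
  rewrite mul1r /=; have [ce|] := boolP (consistent h e); last first.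
    rewrite negb_forall => /existsP[u]; rewrite negb_imply => /andP[ui eu].
    rewrite (bigD1 u)//= /type_trans sumn_children_types extend_types_val.
    by rewrite eq_sym (negPf eu) mul0r.
  under eq_bigr do rewrite type_trans_inner//.
  rewrite big_split /= -/Q /F -mulrA; congr (_ * _).
  rewrite (prod_telescope th nh (weight_neq0 e)).
  rewrite /weight /= rp size_nseq; congr (_ * _).
  under [X in _ = X / _]eq_bigr do rewrite ffunE.
  have -> : \prod_(v : D | leaf h v) weight e v =
     \prod_(v : D | leaf h v && true) weight e v by apply: eq_bigl => v; rewrite andbT.
  rewrite big_leaves big_split /=; congr (_ * _).
    by apply: eq_bigr => v _; rewrite (eqP (valP v)).
  rewrite prodfV; congr (_^-1).
  have -> : \prod_(v : leaves h t) mu ^+ (e (val v) * size (val (val v))) =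
     \prod_(v : leaves h t) mu ^+ (e (val v) * h).
    by apply: eq_bigr => v _; rewrite (eqP (valP v)).
  rewrite -expr_sum -big_distrl /=; congr (mu ^+ (_ * _)); rewrite -[RHS]rp.
  rewrite (consistent_leaves th root)//.
  by apply: eq_bigl => v; rewrite anc_root.
rewrite (sum_consistent th).
rewrite -big_distrr /= -big_distrl /= /Mart -(card_leaves th) Gfun_sum// -/Q.
have mh : mu ^+ (p * h) = mu ^+ (p * n0) * mu ^+ (p * (h - n0)).
  by rewrite -exprD -mulnDr subnKC// ltnW.
rewrite mh; set X := \sum_(_ | _) _.
have m0 : mu ^+ (p * n0) != 0 by rewrite expf_neq0.
have m1 : mu ^+ (p * (h - n0)) != 0 by rewrite expf_neq0.
have f0 : phid phi a mu p n0 != 0 by exact: phid_neq0.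
have p0 : p`!%:R != 0 :> R by rewrite pnatr_eq0 -lt0n fact_gt0.
move: m0 m1 f0 p0; move: (mu ^+ _) (mu ^+ _) (phid _ _ _ _ _) (_`!%:R) X.
by move=> M0 M1 P0 N X m0 m1 f0 p0'; field; rewrite m0 m1 f0 p0'.
Qed.

End TypedTreeWeights.

(** * Laws on the space of trees *)

Section TruncEvents.
Variable k : nat.
Implicit Types (t tau : tree k).

Definition trunc_event h t : set (tree k) := [set tau | restr h tau = nodes t].

Lemma measurable_trunc_event h t : height_le h t ->
  @measurable _ (tree_space k) (trunc_event h t).
Proof. by move=> th; apply: sub_sigma_algebra; exists h, t. Qed.

Lemma restr_restr h h' (t : set word) : (h <= h')%N ->
  restr h (restr h' t) = restr h t.
Proof.
move=> hh'; apply/seteqP; split => [v [[tv _] vh]//|v [tv vh]].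
by split=> //; split=> //; exact: leq_trans hh'.
Qed.

(** Two truncation events are nested or disjoint, whence the empty set. *)
Definition trunc_pi : set_system (tree k) := @all_trunc_events k `|` [set set0].

Lemma trunc_piI : setI_closed trunc_pi.
Proof.
have key h t h' t' : (h <= h')%N -> height_le h' t' ->
    trunc_pi (trunc_event h t `&` trunc_event h' t').
  move=> hh' th'.
  have [tt'|tt'] := pselect (restr h t' = nodes t).
    left; exists h', t' => //; apply/seteqP; split=> [tau []//|tau tauE].
    by split=> //; rewrite /trunc_event /= -tt' -tauE restr_restr.
  right; apply/seteqP; split=> // tau [tauE tauE'].
  by apply: tt'; rewrite -tauE' restr_restr.
move=> A B [[h [t th ->]]|->]; last by rewrite set0I; right.
move=> [[h' [t' th' ->]]|->]; last by rewrite setI0; right.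
have [hh'|/ltnW h'h] := leqP h h'; first exact: key.
by rewrite setIC; exact: key.
Qed.

Lemma restr_root tau : restr k tau = [set ones k].
Proof.
apply/seteqP; split=> [v [tv vk]|v ->]; last first.
  by split; [exact: tree_root|rewrite size_nseq].
by rewrite /= -(tree_take_root tv) take_oversize.
Qed.

Lemma trunc_piT : trunc_pi setT.
Proof.
left; exists k, (root_tree k); first by move=> v ->; rewrite size_nseq.
by apply/seteqP; split=> // tau _; rewrite /= restr_root.
Qed.

Lemma trunc_pi_generates : @measurable _ (tree_space k) = <<s trunc_pi >>.
Proof.
apply/seteqP; split; first by apply: sub_sigma_algebra2 => A ?; left.
apply: smallest_sub; first exact: smallest_sigma_algebra.
by move=> A [?|->]; [exact: sub_sigma_algebra|exact: measurable0].
Qed.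

(** All the events with h = k are the whole space, which also provides the
    covering required by uniqueness of measures. *)
Lemma tree_law_unique (R : realType) (P Q : probability (tree_space k) R) :
  (forall h t, (k < h)%N -> height_le h t ->
    P (trunc_event h t) = Q (trunc_event h t)) ->
  forall A : set (tree_space k), measurable A -> P A = Q A.
Proof.
move=> PQ A mA.
apply: (@measure_unique _ R (tree_space k) trunc_pi (fun=> setT)
  trunc_pi_generates trunc_piI _ _ P Q _ _ A mA).
- by move=> _; exact: trunc_piT.
- by rewrite bigcup_const//; exists 0%N.
- move=> B [[h [t th ->]]|->]; last by rewrite !measure0.
  have hk : (k <= h)%N by have := th _ (tree_root t); rewrite size_nseq.
  move: hk; rewrite leq_eqVlt => /predU1P[kh|hk]; last exact: PQ.
  have -> : [set tau : tree k | restr h tau = t] = setT.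
    have tE : nodes t = [set ones k].
      rewrite -(restr_root t); apply/seteqP; split=> [v tv|v []//].
      by split=> //; rewrite kh; exact: th.
    by apply/seteqP; split=> // tau _; rewrite /= -kh tE restr_root.
  exact: etrans (probability_setT P) (esym (probability_setT Q)).
- by move=> _; apply: le_lt_trans (probability_le1 P measurableT) (ltry _).
Qed.

End TruncEvents.

Section Laws.
Context {R : realType}.
Variables (q : nat -> R) (phi : R -> R) (a mu : R) (p n0 : nat).

Lemma multitype_trunc_event (Q : probability (tree_space n0) R) h (t : tree n0)
    (th : height_le h t) : (n0 < h)%N ->
  is_multitype_tree_law q phi a mu p Q ->
  Q (trunc_event h t) =
  (\sum_(e : {ffun node_fset t -> 'I_p.+1})
     ((extend_types e (ones n0) == p :> nat)%:R *
      \prod_(u : node_fset t | inner h u)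
        type_trans q phi a mu (size (val u)) (extend_types e (val u))
          (children_types t (extend_types e) (val u))))%:E.
Proof.
move=> nh [P HP QP]; rewrite QP; last exact: measurable_trunc_event.
pose E (e : {ffun node_fset t -> 'I_p.+1}) := typed_event h t (extend_types e).
have -> : [set s : typed_tree n0 p | trunc_event h t (forget s)] =
    \bigcup_(e in setT) E e.
  apply/seteqP; split=> [s st|s [e _ []]//].
  exists [ffun v => type_of s (val v)] => //; split=> // u tu.
  have uD : u \in node_fset t by apply/(node_fsetP th).
  by rewrite -[u]/(val (FSetSub uD)) extend_types_val ffunE.
rewrite measure_fin_bigcup.
- rewrite (fsbigE (index_enum _))//=; first last.
  + by move=> e _; rewrite mem_index_enum.
  + exact: index_enum_uniq.
  rewrite -sumEFin; apply: eq_big => [e|e _]; first exact: in_setT.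
  by rewrite HP// (fsbig_inner th).
- exact: finite_finset.
- move=> e e' _ _ [s [[_ se] [_ se']]]; apply/ffunP => v.
  rewrite -(extend_types_val e) -(extend_types_val e').
  have tv : nodes t (val v) by apply/(node_fsetP th)/valP.
  by rewrite -se// -se'.
- by move=> e _; apply: sub_sigma_algebra; exists h, t, (extend_types e).
Qed.

Lemma martingale_trunc_event (P Q : probability (tree_space n0) R) h (t : tree n0) :
  height_le h t -> (n0 < h)%N -> is_GW q P ->
  is_change_of_measure phi a mu p P Q ->
  Q (trunc_event h t) = (Mart phi a mu p h t *
    \prod_(u : node_fset t | inner h u) q (nb_children t (val u)))%:E.
Proof.
move=> th nh GW /(_ h (ltnW nh) (trunc_event h t)) -> ; last first.
  by apply: sub_sigma_algebra; exists t.
rewrite (eq_integral (cst (Mart phi a mu p h t)%:E)); last first.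
  move=> tau /set_mem tauE /=; congr (_%:E).
  rewrite /Mart; congr (_ * Gfun _ _ _ _ _ _ _%:R); rewrite /gen_size -tauE.
  congr (#|` fset_set _|%fset); apply/seteqP; split=> v /=.
    by move=> [tv vh]; split=> //; split=> //; rewrite vh.
  by move=> [[tv _] vh].
rewrite integral_cst; last exact: measurable_trunc_event.
rewrite -(fsbig_inner th _ (fun u => q (nb_children t u)))// [RHS]EFinM.
by congr (_ * _)%E; exact: GW.
Qed.

End Laws.

(** W is almost surely nonnegative as a limit of nonnegative ratios; its
    absolute value is nonnegative everywhere. *)
Lemma laplace_lmoment (R : realType) (mu : R) (P : probability (tree_space 0) R)
    (W : {RV P >-> R}) : 0 < mu -> is_limit_W mu W ->
  forall b, laplace W b = lmoment P (fun x => `|W x|) 0 b.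
Proof.
move=> mu0 hW b.
have W0 : {ae P, forall x, `|W x| = W x}.
  apply: filterS hW => x Wx; rewrite ger0_norm//.
  apply: (cvgr_to_ge Wx); apply: nearW => n.
  by rewrite divr_ge0// exprn_ge0// ltW.
rewrite /laplace /lmoment unlock /Rintegral; congr fine.
apply: ae_eq_integral => //.
- apply/measurable_EFinP; apply: measurableT_comp => //.
  exact: measurable_funM.
- apply/measurable_EFinP; apply: measurable_lmoment.
  exact: measurableT_comp.
- by apply: filterS W0 => x -> _; rewrite expr0 mul1r.
Qed.

(** The martingale carries the inverse of this number as a factor, hence would
    be identically 0, against the total mass 1 of Q. *)
Lemma phid_root_neq0 (R : realType) (phi : R -> R) (a mu : R) (p n0 : nat)
    (P Q : probability (tree_space n0) R) :
  is_change_of_measure phi a mu p P Q -> phid phi a mu p n0 != 0.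
Proof.
move=> /(_ n0 (leqnn n0) setT) H; apply/eqP => phi0.
have : Q setT = 0%E.
  rewrite H; last first.
    have -> : [set: tree n0] = trunc_event n0 (root_tree n0).
      by apply/seteqP; split=> // tau _; rewrite /trunc_event /= restr_root.
    apply: sub_sigma_algebra; exists (root_tree n0) => //.
    by move=> v ->; rewrite size_nseq.
  apply: integral0_eq => tau _; congr (_%:E).
  rewrite /Mart /Gfun; case: p phi0 {H} => [|p] ->.
    by rewrite invr0 !mulr0.
  by rewrite invr0 mulr0 mul0r mulr0.
by rewrite (probability_setT Q) => /eqP; rewrite onee_eq0.
Qed.

Theorem theorem4p9 (R : realType) (p : nat) (a : R) (q : nat -> R) (mu : R)
    (P0 : probability (tree_space 0) R) (W : {RV P0 >-> R})
    (ha : 0 <= a)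
    (hq : offspring_distribution q)
    (hmu : has_mean q mu)
    (hmu1 : 1 < mu)
    (hmoment : has_moment q p)
    (hP0 : is_GW q P0)
    (hLlogL : (p < 2)%N -> LlogL P0)
    (hW : is_limit_W mu W)
    (n0 : nat)
    (Pn0 : probability (tree_space n0) R)
    (hPn0 : is_GW q Pn0)
    (Qmart : probability (tree_space n0) R)
    (hQmart : is_change_of_measure (laplace W) a mu p Pn0 Qmart)
    (Qtype : probability (tree_space n0) R)
    (hQtype : is_multitype_tree_law q (laplace W) a mu p Qtype) :
  forall A : set (tree_space n0), measurable A -> Qtype A = Qmart A.
Proof.
have mu_gt0 : 0 < mu by exact: lt_trans hmu1.
have mun_gt0 n : 0 < mu ^+ n by rewrite exprn_gt0.
have a_ge0 n : 0 <= a / mu ^+ n by rewrite divr_ge0// ltW.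
have phiE := laplace_lmoment mu_gt0 hW.
have mV : measurable_fun setT (fun x => `|W x|) by exact: measurableT_comp.
have V_ge0 x : 0 <= `|W x| by [].
have phid_neq0 l n : (l <= p)%N -> (n0 <= n)%N -> phid (laplace W) a mu l n != 0.
  move=> lp _; apply: (deriven_laplace_neq0 mV V_ge0 phiE (a_ge0 n0)
    (phid_root_neq0 hQmart) lp).
  move: ha; rewrite le_eqVlt => /predU1P[<-|a0]; first by rewrite !mul0r eqxx orbT.
  by rewrite divr_gt0.
have phid0_gt0 n : 0 < phid (laplace W) a mu 0 n.
  by rewrite /phid /= phiE; apply: lmoment_gt0 => //; [right|left].
apply: tree_law_unique => h t nh th.
rewrite (multitype_trunc_event th nh hQtype) (martingale_trunc_event th nh hPn0 hQmart).
by rewrite (sum_type_trans q (lt0r_neq0 mu_gt0) nh th phid_neq0 (phid0_gt0 h)).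
Qed.
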